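(* Let $S$ be a finite set, $d\geq 1$ an integer, $\Omega=S^{\mathbb{Z}^d}$, and let $\Phi$ be a shift-invariant uniformly (i.e. absolutely) summable potential on $\Omega$. If $\mu$ is an ergodic equilibrium state for $\Phi$ and $\mu$ satisfies a Gaussian concentration bound, then $\mu$ is the unique equilibrium state for $\Phi$.
   Context: $\Omega=S^{\mathbb{Z}^d}$ ($S$ finite) carries the product topology and its Borel $\sigma$-algebra $\mathfrak{B}$; for $\Lambda\subset\mathbb{Z}^d$, $\mathfrak{B}_\Lambda$ is the $\sigma$-algebra generated by the coordinates $\omega\mapsto\omega_x$, $x\in\Lambda$. $\Lambda\Subset\mathbb{Z}^d$ means $\Lambda$ is a finite subset. $\omega_\Lambda\eta_{\Lambda^c}$ is the configuration equal to $\omega$ on $\Lambda$ and to $\eta$ on $\Lambda^c$. Shift: $(\theta_x\omega)_y=\omega_{y-x}$ for $x,y\in\mathbb{Z}^d$. A probability measure on $(\Omega,\mathfrak{B})$ is shift-invariant if it is invariant under every $\theta_x$; a shift-invariant probability measure is ergodic if it is trivial on the $\sigma$-algebra of events $A\in\mathfrak{B}$ with $\theta_xA=A$ for all $x\in\mathbb{Z}^d$. Potential: a family $(\Phi(\Lambda,\cdot))_{\emptyset\neq\Lambda\Subset\mathbb{Z}^d}$ of functions $\Phi(\Lambda,\cdot):\Omega\to\mathbb{R}$, with $\Phi(\Lambda,\cdot)$ $\mathfrak{B}_\Lambda$-measurable. It is shift-invariant if $\Phi(\Lambda+x,\theta_x\omega)=\Phi(\Lambda,\omega)$ for all $\Lambda,\omega,x$,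 and uniformly (absolutely) summable if $\sum_{\Lambda\Subset\mathbb{Z}^d,\,\Lambda\ni 0}\|\Phi(\Lambda,\cdot)\|_\infty<\infty$. Gibbs measures: for $\Lambda\Subset\mathbb{Z}^d$ and $\omega,\eta\in\Omega$ put $$\mathcal{H}_\Lambda(\omega|\eta)=\sum_{\Lambda'\Subset\mathbb{Z}^d,\ \Lambda'\cap\Lambda\neq\emptyset}\Phi(\Lambda',\omega_\Lambda\eta_{\Lambda^c}),\qquad \gamma^\Phi_\Lambda(\omega|\eta)=\frac{\exp(-\mathcal{H}_\Lambda(\omega|\eta))}{Z_\Lambda(\eta)},$$ where $Z_\Lambda(\eta)=\sum_{\omega\in S^\Lambda}\exp(-\mathcal{H}_\Lambda(\omega|\eta))$. A probability measure $\mu$ on $(\Omega,\mathfrak{B})$ is a Gibbs measure for $\Phi$ if for every $\Lambda\Subset\mathbb{Z}^d$ and every $A\in\mathfrak{B}$, $$\mu(A)=\int\sum_{\omega'\in S^\Lambda}\gamma^\Phi_\Lambda(\omega'|\eta)\,\mathbf{1}_A(\omega'_\Lambda\eta_{\Lambda^c})\,d\mu(\eta).$$ An equilibrium state for $\Phi$ is a shift-invariant Gibbs measure for $\Phi$. (By the variational principle, for shift-invariant $\nu$ and any shift-invariant Gibbs measure $\mu$ for $\Phi$, this is equivalent to $\nu$ having relative entropy density $h(\nu|\mu)=0$, where $h(\nu|\mu)=\lim_{n\to\infty}(2n+1)^{-d}\sum_{p\in S^{\Lambda_n}}\nu([p])\log\frac{\nu([p])}{\mu([p])}$, $\Lambda_n=[-n,n]^d\cap\mathbb{Z}^d$,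 $[p]=\{\omega\in\Omega:\omega_{\Lambda_n}=p\}$.) Gaussian concentration bound: a function $F:\Omega\to\mathbb{R}$ is local if it is $\mathfrak{B}_\Lambda$-measurable for some $\Lambda\Subset\mathbb{Z}^d$. For $x\in\mathbb{Z}^d$, $\delta_x(F)=\sup\{|F(\omega)-F(\omega')|:\omega,\omega'\in\Omega \text{ differ only at site } x\}$. A probability measure $\mu$ on $(\Omega,\mathfrak{B})$ satisfies a Gaussian concentration bound if there is a constant $D>0$ such that for every local function $F$, $$\int\exp\Big(F-\int F\,d\mu\Big)d\mu\leq\exp\Big(D\sum_{x\in\mathbb{Z}^d}\delta_x(F)^2\Big).$$ *)

(* Defs.v *)
From HB Require Import structures.
From mathcomp Require Import all_boot all_order all_algebra finmap.
From mathcomp Require Import all_classical all_reals all_analysis.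

Set Implicit Arguments.
Unset Strict Implicit.
Unset Printing Implicit Defensive.

Import Order.TTheory GRing.Theory Num.Theory.

Local Open Scope classical_set_scope.
Local Open Scope ring_scope.

(* The measurable types of MathComp-Analysis are pointed, so the spin set S is
   a finite type with a distinguished element. That element is otherwise never
   used, and for empty S there are no probability measures on Omega anyway. *)
#[short(type="pointedFinType")]
HB.structure Definition PointedFinite := {T of Finite T & Pointed T}.

Section Configurations.
Variables (S : pointedFinType) (d : nat).

Definition lattice := 'rV[int]_d.

Definition config := prod_topology (fun _ : lattice => discrete_topology S).

Definition borel_config := g_sigma_algebraType (@open config).

Definition shift_config (x : lattice) (w : config) : config :=
  fun y => w (y - x).

Definition translate (x : lattice) (L : {fset lattice}) : {fset lattice} :=
  [fset (y + x)%R | y in L]%fset.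

(* p_L eta_{L^c} for p in S^L. A configuration w enters H_L(w|eta) and
   gamma_L(w|eta) only through w_L, which is why these are defined below
   directly for p in S^L. *)
Definition glue_config (L : {fset lattice}) (p : {ffun L -> S})
    (eta : config) : config :=
  fun x => if insub x is Some y then p y else eta x.

Definition coordinate_sets (L : {fset lattice}) : set (set config) :=
  [set A | exists x, x \in L /\ exists B : set S, A = [set w | B (w x)]].

Definition coordinate_algebra (L : {fset lattice}) :=
  g_sigma_algebraType (coordinate_sets L).

End Configurations.

Section Gibbs.
Variables (R : realType) (S : pointedFinType) (d : nat).
Local Notation Zd := (lattice d).
Local Notation Omega := (config S d).
Local Notation measure_on_Omega := (probability (borel_config S d) R).

Definition measurable_in (L : {fset Zd}) (F : Omega -> R) : Prop :=
  measurable_fun setT (F : coordinate_algebra S L -> R).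

Definition is_local (F : Omega -> R) : Prop :=
  exists L : {fset Zd}, measurable_in L F.

(* The value at the empty set is unconstrained and never used. *)
Definition is_potential (Phi : {fset Zd} -> Omega -> R) : Prop :=
  forall L, L != fset0 -> measurable_in L (Phi L).

Definition shift_invariant_potential (Phi : {fset Zd} -> Omega -> R) : Prop :=
  forall L w x, L != fset0 ->
  Phi (translate x L) (shift_config x w) = Phi L w.

Definition sup_norm (F : Omega -> R) : \bar R :=
  ereal_sup [set `|F w|%:E | w in [set: Omega]].

Definition uniformly_summable (Phi : {fset Zd} -> Omega -> R) : Prop :=
  (\esum_(L in [set L : {fset Zd} | 0%R \in L]) sup_norm (Phi L) < +oo)%E.

(* Sum of an absolutely summable real family: esum is meant for nonnegative
   terms, so positive and negative parts are summed separately. *)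
Definition absolute_sum (I : choiceType) (D : set I) (f : I -> R) : R :=
  fine (esum D (EFin \o f)^\+ - esum D (EFin \o f)^\-)%E.

Definition hamiltonian (Phi : {fset Zd} -> Omega -> R) (L : {fset Zd})
    (p : {ffun L -> S}) (eta : Omega) : R :=
  absolute_sum [set L' : {fset Zd} | (L' `&` L)%fset != fset0]
    (fun L' => Phi L' (glue_config p eta)).

Definition partition_function (Phi : {fset Zd} -> Omega -> R) (L : {fset Zd})
    (eta : Omega) : R :=
  \sum_(p : {ffun L -> S}) expR (- hamiltonian Phi p eta).

Definition specification (Phi : {fset Zd} -> Omega -> R) (L : {fset Zd})
    (p : {ffun L -> S}) (eta : Omega) : R :=
  expR (- hamiltonian Phi p eta) / partition_function Phi L eta.

Definition is_gibbs (Phi : {fset Zd} -> Omega -> R) (mu : measure_on_Omega) :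
    Prop :=
  forall (L : {fset Zd}) (A : set (borel_config S d)), measurable A ->
  mu A = (\int[mu]_eta
    (\sum_(p : {ffun L -> S})
       specification Phi p eta * \1_A (glue_config p eta))%:E)%E.

Definition shift_invariant (mu : measure_on_Omega) : Prop :=
  forall (x : Zd) (A : set (borel_config S d)), measurable A ->
  mu (shift_config x @^-1` A) = mu A.

Definition is_ergodic (mu : measure_on_Omega) : Prop :=
  shift_invariant mu /\
  forall A : set (borel_config S d), measurable A ->
  (forall x : Zd, shift_config x @` A = A) -> mu A = 0%E \/ mu A = 1%E.

Definition is_equilibrium (Phi : {fset Zd} -> Omega -> R)
    (mu : measure_on_Omega) : Prop :=
  shift_invariant mu /\ is_gibbs Phi mu.

(* Pairs with w = w' are allowed: they contribute 0, and make the supremum 0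
   rather than -oo when S is a singleton. *)
Definition oscillation (F : Omega -> R) (x : Zd) : \bar R :=
  ereal_sup [set r | exists w w' : Omega,
    (forall y, y != x -> w y = w' y) /\ r = `|F w - F w'|%:E].

Definition gaussian_concentration (mu : measure_on_Omega) : Prop :=
  exists2 D : R, 0 < D & forall F : Omega -> R, is_local F ->
  (\int[mu]_w (expR (F w - \int[mu]_w' F w')%R)%:E
   <= expeR (D%:E * \esum_(x in [set: Zd]) (oscillation F x ^+ 2)))%E.

End Gibbs.

(* Main.v *)
Require Import Defs.
From HB Require Import structures.
From mathcomp Require Import all_boot all_order all_algebra finmap.
From mathcomp Require Import zify ring lra.
From mathcomp Require Import all_classical all_reals all_analysis.

(** For another equilibrium state [nu], the probabilities of a cylinder over a
    window [V] under [mu] and [nu] differ by a factor at most [exp (4 b)], where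
    [b] is the energy of the interactions that cross the boundary of [V]; along a
    Folner sequence [b = o(|V|)] by absolute summability. The Gaussian bound for
    [F = t * \sum_(x in I) 1_A o shift_x], whose mean under both measures is
    given by shift invariance, therefore passes to [nu] at the cost of [4 b], and
    Jensen's inequality yields [t |I| (nu A - mu A) <= 4 b + K t^2 |V|]. Dividing
    by [t |V|] and letting [V] grow, then [t] tend to [0], gives [nu A <= mu A]
    for every local event [A]; apply this to the complement of [A] too. *)

Set Implicit Arguments.
Unset Strict Implicit.
Unset Printing Implicit Defensive.

Import Order.TTheory GRing.Theory Num.Theory.

Local Open Scope classical_set_scope.
Local Open Scope ring_scope.

(** * Local functions and events *)

Section LocalFunctions.
Variables (S : pointedFinType) (d : nat).
Local Notation Zd := (lattice d).
Local Notation Omega := (config S d).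
Implicit Types (L V : {fset Zd}) (w eta : Omega).

Definition agree_on L w w' := forall x, x \in L -> w x = w' x.

(** The codomain is arbitrary so that [T := R] covers local functions and [T := Prop] covers local
    events. *)
Definition determined_by (T : Type) L (F : Omega -> T) :=
  forall w w', agree_on L w w' -> F w = F w'.

Definition local_sets : set (set Omega) :=
  [set A | exists L, determined_by L A].

Definition restrict_config L w : {ffun L -> S} := [ffun y => w (val y)].

Definition cylinder L (p : {ffun L -> S}) : set Omega :=
  [set w | restrict_config L w = p].

Lemma glue_in L (p : {ffun L -> S}) eta (x : L) :
  glue_config p eta (val x) = p x.
Proof. by rewrite /glue_config valK. Qed.

Lemma restrict_glue L (p : {ffun L -> S}) eta :
  restrict_config L (glue_config p eta) = p.
Proof. by apply/ffunP => x; rewrite ffunE glue_in. Qed.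

Lemma glue_restrict L w eta :
  agree_on L (glue_config (restrict_config L w) eta) w.
Proof. by move=> x xL; rewrite -[x]/(val [` xL]%fset) glue_in ffunE. Qed.

Lemma agree_glue L L' (p : {ffun L -> S}) eta eta' :
  (L' `<=` L)%fset -> agree_on L' (glue_config p eta) (glue_config p eta').
Proof.
by move=> /fsubsetP L'L x /L'L xL; rewrite -[x]/(val [` xL]%fset) !glue_in.
Qed.

Lemma agree_sub L L' w w' :
  (L' `<=` L)%fset -> agree_on L w w' -> agree_on L' w w'.
Proof. by move=> /fsubsetP L'L ww' x /L'L /ww'. Qed.

Lemma agree_restrict L w w' :
  restrict_config L w = restrict_config L w' -> agree_on L w w'.
Proof.
move=> /ffunP ww' x xL; have := ww' [` xL]%fset.
by rewrite !ffunE.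
Qed.

Lemma determined_restrict T L (F : Omega -> T) w eta : determined_by L F ->
  F (glue_config (restrict_config L w) eta) = F w.
Proof. by apply; exact: glue_restrict. Qed.

Lemma determined_cylinder L (p : {ffun L -> S}) : determined_by L (cylinder p).
Proof.
move=> w w' ww'; rewrite /cylinder /=; congr (_ = _).
by apply/ffunP => x; rewrite !ffunE ww' ?fsvalP.
Qed.

(** Since [S] and [L] are finite, such an event is a finite union of cylinders over [L], each a
    finite intersection of coordinate sets. *)
Lemma determined_measurable L (A : set Omega) : determined_by L A ->
  measurable (A : set (coordinate_algebra S L)).
Proof.
move=> dA.
have -> : A = \bigcup_(p in [set p | A (glue_config p point)])
    \bigcap_(x in [set: L]) [set w | w (val x) = p x].
  apply/seteqP; split=> [w Aw|w [p /= Ap wp]].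
    exists (restrict_config L w) => [/=|x _ /=]; last by rewrite ffunE.
    by rewrite determined_restrict.
  rewrite (dA w (glue_config p point))// => x xL.
  by rewrite -[x]/(val [` xL]%fset) glue_in; exact: wp.
apply: fin_bigcup_measurable => [|p _]; first exact: finite_finset.
apply: fin_bigcap_measurable => [|x _]; first exact: finite_finset.
apply: sub_sigma_algebra; exists (val x); split; first exact: fsvalP.
by exists [set p x].
Qed.

Lemma open_coordinate L : @coordinate_sets S d L `<=` @open Omega.
Proof.
move=> _ [x [xL [B ->]]].
apply: (@open_comp Omega (discrete_topology S) (fun w => w x) B).
  move=> w _; exact: (@proj_continuous Zd (fun=> discrete_topology S) x w).
exact: discrete_open.
Qed.

(** The sets containing a cylinder around [w] form a filter. It converges to [w] in the product
    topology, so every open neighbourhood of [w] belongs to it. *)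
Lemma open_cylinder (U : set Omega) w : open U -> U w ->
  exists L, forall w', agree_on L w w' -> U w'.
Proof.
move=> oU Uw.
pose F : set_system Omega :=
  [set A | exists L, forall w', agree_on L w w' -> A w'].
have FF : Filter F.
  split.
  - by exists fset0.
  - move=> A B [L LA] [L' LB]; exists (L `|` L')%fset => w' ww'; split.
    by apply: LA; apply: agree_sub ww'; exact: fsubsetUl.
    by apply: LB; apply: agree_sub ww'; exact: fsubsetUr.
  - by move=> A B AB [L LA]; exists L => w' /LA/AB.
(* Convergence is tested one coordinate [x] at a time, where the window consisting of [x] alone
   suffices. *)
have : F --> w.
  apply/cvg_sup => x A [V] [[W] oW <-] Ww WA.
  exists [fset x]%fset => w' ww'; apply: WA => /=.
  by rewrite -ww' ?inE.
by apply; apply: open_nbhs_nbhs.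
Qed.

(** For fixed [w] and [w'] agreeing on [L], the events that do not separate them form a
    sigma-algebra containing the coordinate sets. *)
Lemma measurable_coordinate_determined L (A : set (coordinate_algebra S L)) :
  measurable A -> determined_by L (A : set Omega).
Proof.
move=> mA w w' ww'.
suff : <<s @coordinate_sets S d L >> `<=` [set A | A w = A w'] by exact.
apply: smallest_sub.
  split=> //=.
  - move=> B /= BE; by apply: (congr2 and erefl); congr (~ _).
  - move=> F FE; rewrite /bigcup /=; apply/propext.
    by split=> -[i _ Fi]; exists i; rewrite // ?FE// -FE.
by move=> _ [x [xL [B ->]]] /=; rewrite ww'.
Qed.

Lemma measurable_inP (R : realType) L (F : Omega -> R) :
  measurable_in L F <-> determined_by L F.
Proof.
split=> [mF|dF]; last first.
  move=> _ Y mY; rewrite setTI; apply: determined_measurable => w w' /dF.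
  by rewrite /preimage/= => ->.
move=> w w' ww'.
have := mF measurableT [set F w] (measurable_set1 _).
rewrite setTI => /measurable_coordinate_determined/(_ _ _ ww').
by rewrite /preimage /= => E; apply: esym; rewrite -E.
Qed.

Lemma local_set_measurable (A : set (borel_config S d)) :
  local_sets A -> measurable A.
Proof.
move=> [L dA].
exact: (sub_sigma_algebra2 (@open_coordinate L) (determined_measurable dA)).
Qed.

(** An open set is the union of the cylinders it contains, and there are only countably many
    cylinders in all. *)
Lemma borel_local_sets :
  @measurable _ (borel_config S d) = <<s local_sets >>.
Proof.
apply/seteqP; split; last first.
  apply: smallest_sub; first exact: sigma_algebra_measurable.
  exact: local_set_measurable.
apply: smallest_sub; first exact: smallest_sigma_algebra.
move=> U oU.
pose C (i : {L : {fset Zd} & {ffun L -> S}}) := cylinder (tagged i).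
have -> : U = \bigcup_(i in [set i | C i `<=` U]) C i.
  apply/seteqP; split=> [w Uw|w [i /= iU]]; last exact: iU.
  have [L LU] := open_cylinder oU Uw.
  exists (existT _ L (restrict_config L w)) => //= w' ww'.
  by apply/LU/agree_restrict; rewrite ww'.
rewrite bigcup_mkcond.
apply: (@countable_bigcupT_measurable _ (g_sigma_algebraType local_sets)).
  exact: countableP.
move=> i; case: ifPn => _ ; last exact: measurable0.
by apply: sub_sigma_algebra; exists (tag i); exact: determined_cylinder.
Qed.

End LocalFunctions.

(* Unlike [ge0_le_integral], this applies to the specification as a function of the
   boundary condition without a proof that it is measurable. *)
Lemma le_integral_pointwise d (T : measurableType d) (R : realType)
    (mu : {measure set T -> \bar R}) (f g : T -> \bar R) :
  (forall x, 0 <= f x)%E -> (forall x, f x <= g x)%E ->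
  (\int[mu]_x f x <= \int[mu]_x g x)%E.
Proof.
move=> f0 fg; have g0 x : (0 <= g x)%E := le_trans (f0 x) (fg x).
rewrite !ge0_integralTE//; apply: ereal_sup_le => _ [h /= hf <-].
by exists h => //= x; exact: le_trans (hf x) (fg x).
Qed.

(** * Integrals of local functions as finite sums over patterns *)

Section LocalIntegrals.
Variables (R : realType) (S : pointedFinType) (d : nat).
Local Notation Zd := (lattice d).
Local Notation Omega := (config S d).
Implicit Types (mu nu : probability (borel_config S d) R) (V : {fset Zd}).

Definition mass mu V (p : {ffun V -> S}) : R :=
  fine (mu (cylinder p : set (borel_config S d))).

Lemma massE mu V (p : {ffun V -> S}) :
  mu (cylinder p : set (borel_config S d)) = (mass mu p)%:E.
Proof.
rewrite fineK// fin_num_measure//; apply: local_set_measurable.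
by exists V; exact: determined_cylinder.
Qed.

Lemma mass_ge0 mu V (p : {ffun V -> S}) : 0 <= mass mu p.
Proof. exact: fine_ge0. Qed.

Lemma sum_cylinder V (F : Omega -> R) eta w : determined_by V F ->
  F w = \sum_(p : {ffun V -> S}) F (glue_config p eta) * \1_(cylinder p) w.
Proof.
move=> dF; rewrite (bigD1 (restrict_config V w))//= big1 => [|p pw].
  by rewrite addr0 indicE mem_set// mulr1 determined_restrict.
rewrite indicE memNset ?mulr0// => wp; move: pw.
by rewrite -wp eqxx.
Qed.

(** [F] is constant on each cylinder over [V]; its value there can be read off at any extension of
    the pattern, here the one by [eta]. *)
Lemma integral_determined mu V (F : Omega -> R) eta : determined_by V F ->
  (\int[mu]_w (F w)%:E =
   (\sum_(p : {ffun V -> S}) F (glue_config p eta) * mass mu p)%:E)%E.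
Proof.
move=> dF.
have mc (p : {ffun V -> S}) : measurable (cylinder p : set (borel_config S d)).
  by apply: local_set_measurable; exists V; exact: determined_cylinder.
under eq_integral do rewrite (sum_cylinder eta _ dF) -sumEFin.
rewrite integral_sum//; last first.
  move=> p; under [X in integrable _ _ X]eq_fun do rewrite EFinM.
  by apply: integrableZl => //; exact: integrable_indic.
rewrite -sumEFin; apply: eq_bigr => p _.
under eq_integral do rewrite EFinM.
rewrite integralZl//; last exact: integrable_indic.
rewrite integral_indic// setIT EFinM; congr (_ * _)%E.
exact: massE.
Qed.

Lemma determined_indic V (A : set Omega) : determined_by V A ->
  determined_by V (\1_A : Omega -> R).
Proof.
move=> dA w w' ww'; rewrite !indicE.
by have -> : (w \in A) = (w' \in A) by apply/idP/idP; rewrite !inE (dA _ _ ww').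
Qed.

Lemma prob_determined mu V (A : set Omega) eta : determined_by V A ->
  mu (A : set (borel_config S d)) =
   (\sum_(p : {ffun V -> S}) \1_A (glue_config p eta) * mass mu p)%:E.
Proof.
move=> dA; rewrite -(integral_determined mu eta (determined_indic dA)).
rewrite integral_indic ?setIT//.
by apply: local_set_measurable; exists V.
Qed.

Lemma sum_mass mu V : \sum_(p : {ffun V -> S}) mass mu p = 1.
Proof.
have := @prob_determined mu V setT point (fun _ _ _ => erefl).
rewrite probability_setT => -[->]; apply: eq_bigr => p _.
by rewrite indicE mem_set// mul1r.
Qed.

(** Local events are stable under intersection and generate the Borel sets, so uniqueness of
    measures applies. *)
Lemma eq_of_local mu nu :
  (forall A, local_sets A -> nu (A : set (borel_config S d)) = mu A) ->
  forall A : set (borel_config S d), measurable A -> nu A = mu A.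
Proof.
move=> numu A; apply: (@measure_unique _ R (borel_config S d) (@local_sets S d)
  (fun=> setT) _ _ _ _ nu mu).
- exact: borel_local_sets.
- move=> B C [L LA] [L' LB]; exists (L `|` L')%fset => w w' ww'.
  apply: (congr2 and); [apply: LA|apply: LB];
    apply: agree_sub ww'; [exact: fsubsetUl|exact: fsubsetUr].
- by move=> _; exists fset0.
- exact: bigcup_const.
- exact: numu.
- by move=> _; apply: le_lt_trans (ltry 1); exact: (@probability_le1 _ _ _ nu).
Qed.

End LocalIntegrals.

(** * Boxes *)

Section Boxes.
Variable d : nat.
Local Notation Zd := (lattice d).

(** The cube of side [N] with lowest corner [(a, ..., a)], given as an image of a function type so
    that its cardinality is immediate. *)
Definition box (a : int) (N : nat) : {fset Zd} :=
  [fset (\row_i (a + (f i : nat)%:Z))%R |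
    f : {ffun 'I_d -> 'I_N} in {: {ffun 'I_d -> 'I_N}}]%fset.

Lemma in_box (a : int) (N : nat) (x : Zd) :
  reflect (forall i, a <= x 0 i < a + N%:Z) (x \in box a N).
Proof.
rewrite /box; apply: (iffP (imfsetP _ _ _ _)) => /= [[f _ -> i]|xP].
  by rewrite mxE lerDl lez_nat leq0n ltrD2l ltz_nat ltn_ord.
have xi i : (`|(x 0 i - a)%R| < N)%N.
  have /andP[ax xN] := xP i.
  by rewrite -ltz_nat gez0_abs ?subr_ge0// ltrBlDl.
exists [ffun i => Ordinal (xi i)] => //; apply/rowP => i.
have /andP[ax _] := xP i.
by rewrite mxE ffunE /= gez0_abs ?subr_ge0// addrC subrK.
Qed.

Lemma card_box (a : int) (N : nat) : #|` box a N| = (N ^ d)%N.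
Proof.
rewrite card_imfset /=; last first.
  move=> f g /rowP fg; apply/ffunP => i; apply: val_inj => /=.
  by have := fg i; rewrite !mxE => /addrI [].
by rewrite -cardE card_ffun !card_ord.
Qed.

Lemma bernoulli (R : realDomainType) (s : R) n : 0 <= s <= 1 ->
  1 - n%:R * s <= (1 - s) ^+ n.
Proof.
move=> /andP[s0 s1]; elim: n => [|n IH]; first by rewrite mul0r subr0 expr0.
rewrite exprS; apply: le_trans (ler_wpM2l _ IH); last by rewrite subr_ge0.
rewrite -subr_ge0 (_ : _ - _ = n%:R * s ^+ 2); last by rewrite -natr1; ring.
by rewrite mulr_ge0 ?sqr_ge0.
Qed.

(** With [s = m / (N + m)] the ratio of volumes is [(1 - s) ^ d], at least [1 - d * s] by Bernoulli;
    taking [N >= d * m / eps] makes [d * s <= eps]. *)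
Lemma box_growth (R : archiRealFieldType) (m : nat) (eps : R) : 0 < eps ->
  exists2 N, (0 < N)%N &
    (1 - eps) * ((N + m) ^ d)%:R <= (N ^ d)%:R.
Proof.
move=> eps0; pose c : R := (d * m)%:R / eps.
have c0 : 0 <= c by rewrite divr_ge0// ltW.
exists (Num.bound c).+1 => //; set N := _.+1.
have cN : c <= N%:R by rewrite (le_trans (ltW (archi_boundP c0)))// ler_nat.
have Nm0 : 0 < (N + m)%:R :> R by rewrite ltr0n.
pose s : R := m%:R / (N + m)%:R.
have s01 : 0 <= s <= 1.
  by rewrite divr_ge0//= ler_pdivrMr// mul1r ler_nat leq_addl.
have Ns : N%:R = (1 - s) * (N + m)%:R.
  by rewrite mulrBl mul1r divfK ?gt_eqF// natrD addrK.
rewrite !natrX Ns exprMn ler_wpM2r ?exprn_ge0//.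
apply: le_trans (bernoulli d s01); rewrite lerD2l lerN2 /s mulrA.
rewrite ler_pdivrMr// -natrM -ler_pdivrMl// mulrC (le_trans cN)//.
by rewrite ler_nat leq_addr.
Qed.

(** [V] is a large cube and [I] the same cube with a layer of width [m] removed on every side, where
    [m] bounds all coordinates of points of [B]. *)
Lemma folner (R : archiRealFieldType) (B : {fset Zd}) (eps : R) : 0 < eps ->
  exists V I : {fset Zd}, [/\ (0 < #|` V|)%N,
    forall x y, x \in I -> y \in B -> y + x \in V &
    (1 - eps) * #|` V|%:R <= #|` I|%:R].
Proof.
move=> eps0; pose m := (\sum_(y <- B) \sum_i `|y 0%R i|)%N.
have mP (y : Zd) i : y \in B -> `|y 0 i| <= m%:Z.
  move=> yB; rewrite -abszE lez_nat /m (big_fsetD1 y)//= (bigD1 i)//=.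
  by rewrite -addnA leq_addr.
have [N N0 NP] := box_growth (m + m) eps0.
exists (box 0 (N + (m + m))), (box m%:Z N); split.
- by rewrite card_box expn_gt0 addn_gt0 N0.
- move=> x y /in_box xP yB; apply/in_box => i.
  have := xP i; have := mP _ i yB; rewrite !mxE !PoszD ler_norml.
  move: (x _ i) (y _ i) => u v /andP[v1 v2] /andP[u1 u2]; apply/andP; split; lia.
- by rewrite !card_box.
Qed.

End Boxes.

(** * Unordered sums *)

Section Esum.
Variables (R : realType) (T : choiceType).
Implicit Types (D E : set T) (f g h : T -> \bar R).
Local Open Scope ereal_scope.

Lemma subset_le_esum D E f : D `<=` E -> esum D f <= esum E f.
Proof.
move=> DE; apply: ereal_sup_le => _ [X [fX XD] <-].
by exists X => //; split=> // x /XD/DE.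
Qed.

(** The pieces may overlap: a point of [D] is counted at least once on the right, and all terms are
    nonnegative. *)
Lemma esum_cover (J : choiceType) (r : seq J) D (E : J -> set T) f :
  (forall x, 0 <= f x) -> (forall x, D x -> exists2 j, j \in r & E j x) ->
  esum D f <= \sum_(j <- r) esum (E j) f.
Proof.
move=> f0 DE; rewrite esum_mkcond; under eq_bigr do rewrite esum_mkcond.
have if0 (b : bool) x : 0 <= (if b then f x else 0) by case: b.
rewrite -(@esum_sum _ _ _ setT r xpredT
  (fun x j => if x \in E j then f x else 0))//; apply: le_esum => x _.
case: ifPn => [/set_mem/DE[j jr Ejx]|_]; last exact: sume_ge0.
by rewrite (big_rem j)//= mem_set// leeDl// sume_ge0.
Qed.

(** The total is a supremum of finite partial sums; one within [eps] of it leaves a remainder of at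
    most [eps]. *)
Lemma esum_tail D f (eps : R) : (forall x, 0 <= f x) -> esum D f < +oo ->
  (0 < eps)%R -> exists X, [/\ finite_set X, X `<=` D &
    esum (D `&` ~` X) f <= eps%:E].
Proof.
move=> f0 Doo eps0.
have Dfin : esum D f \is a fin_num.
  by rewrite ge0_fin_numE// esum_ge0.
have : esum D f - eps%:E < esum D f.
  by rewrite lteBlDr// lteDl.
move=> /ereal_sup_gt[_ [X [fX XD] <-]] lt; exists X; split=> //.
have := @esumID R T X D f (fun x _ => f0 x).
rewrite (setIidr XD) (esum_fset fX) => [DE|x _]; last exact: f0.
have Xfin : \sum_(i \in X) f i \is a fin_num.
  rewrite ge0_fin_numE ?fsume_ge0//; apply: le_lt_trans Doo.
  by rewrite DE leeDl// esum_ge0.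
rewrite -(leeD2lE _ _ Xfin) -DE.
by rewrite lteBlDr// in lt; exact: ltW.
Qed.

(* The inequality [f <= g + h] becomes one between nonnegative families once the
   positive and negative parts are moved to the sides where they are added. *)
Lemma absolute_sum_le D (f g h : T -> R) :
  esum D (abse \o (EFin \o f)) < +oo ->
  esum D (abse \o (EFin \o g)) < +oo ->
  (forall x, 0 <= h x)%R -> esum D (EFin \o h) < +oo ->
  (forall x, D x -> f x <= g x + h x)%R ->
  (absolute_sum D f <= absolute_sum D g + fine (esum D (EFin \o h)))%R.
Proof.
move=> sf sg h0 sh fgh.
have fin (k : T -> \bar R) : (forall x, 0 <= k x) -> esum D k < +oo ->
    esum D k \is a fin_num.
  by move=> k0 koo; rewrite ge0_fin_numE// esum_ge0.
have part (k : T -> R) : esum D (abse \o (EFin \o k)) < +oo ->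
    esum D (EFin \o k)^\+ \is a fin_num /\ esum D (EFin \o k)^\- \is a fin_num.
  move=> sk; split; apply: fin => //; apply: le_lt_trans sk; apply: le_esum => x _ /=.
    by rewrite funeposE /= -EFin_max lee_fin ge_max normr_ge0 ler_norm.
  by rewrite funenegE /= -EFin_max lee_fin ge_max normr_ge0 ler_normr lexx orbT.
have [fp fn] := part _ sf; have [gp gn] := part _ sg.
have hf := fin (EFin \o h) h0 sh.
rewrite /absolute_sum -fineD ?fin_numB ?fp ?fn ?gp ?gn//.
rewrite fine_le ?fin_numD ?fin_numN ?fp ?fn ?gp ?gn ?hf//.
rewrite leeBlDr//.
rewrite [leRHS](_ : _ = esum D (EFin \o g)^\+ + esum D (EFin \o h)
   + esum D (EFin \o f)^\- - esum D (EFin \o g)^\-); last first.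
  rewrite -(fineK fn) -(fineK gp) -(fineK gn) -(fineK hf).
  by rewrite -!(EFinD, EFinN); congr EFin; ring.
have H0 x : D x -> 0 <= (EFin \o h) x by move=> _; rewrite lee_fin.
rewrite leeBrDr// -!esumD//; last by move=> x _; rewrite adde_ge0// lee_fin.
apply: le_esum => x Dx; rewrite !funeposE !funenegE /=.
rewrite -!EFin_max -!EFinD lee_fin.
have := fgh x Dx; rewrite /Num.max; do 4 (case: ltP => ?); lra.
Qed.

End Esum.

(** * Boundary energy and comparison of Gibbs measures *)

Section BoundaryEnergy.
Variables (R : realType) (S : pointedFinType) (d : nat).
Local Notation Zd := (lattice d).
Local Notation Omega := (config S d).
Variable Phi : {fset Zd} -> Omega -> R.
Hypotheses (potPhi : is_potential Phi) (shiftPhi : shift_invariant_potential Phi)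
  (sumPhi : uniformly_summable Phi).
Implicit Types (x y : Zd) (L V I B : {fset Zd}) (w eta : Omega).
Local Open Scope ereal_scope.

Definition interaction_norm L : \bar R := sup_norm (Phi L).
Local Notation c := interaction_norm.

Lemma interaction_le L w : `|Phi L w|%:E <= c L.
Proof. by apply: ereal_sup_ubound; exists w. Qed.

Lemma interaction_norm_ge0 L : 0 <= c L.
Proof. by apply: le_trans (interaction_le L point); rewrite lee_fin. Qed.

Lemma in_translate x L y : (y \in translate x L) = ((y - x)%R \in L).
Proof.
apply/imfsetP/idP => [[z /= zL ->]|yL]; first by rewrite addrK.
by exists (y - x)%R => //; rewrite subrK.
Qed.

Lemma translateK x : cancel (@translate d x) (translate (- x)%R).
Proof. by move=> L; apply/fsetP => y; rewrite !in_translate opprK addrK. Qed.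

Lemma shift_configK x : cancel (@shift_config S d (- x)%R) (shift_config x).
Proof. by move=> w; apply/funext => y; rewrite /shift_config opprK subrK. Qed.

Lemma interaction_translate x L : L != fset0 -> c (translate x L) = c L.
Proof.
move=> L0; congr ereal_sup; apply/seteqP; split=> _ [w _ <-].
  exists (shift_config (- x)%R w) => //.
  by rewrite -(shiftPhi _ x L0) shift_configK.
by exists (shift_config x w) => //; rewrite shiftPhi.
Qed.

(** Translation by [x] preserves the norms and matches the sets through the origin with those
    through [x]. This reduces sums at any site to the summability assumption at the origin. *)
Lemma esum_translate x (Q : set {fset Zd}) :
  esum [set L : {fset Zd} | x \in L /\ Q L] c =
  esum [set L : {fset Zd} | 0%R \in L /\ Q (translate x L)] c.
Proof.
rewrite (@reindex_esum _ _ _ [set L : {fset Zd} | 0%R \in L /\ Q (translate x L)] _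
  (translate x)).
  apply: eq_esum => L [L0 _]; apply: interaction_translate.
  by apply/fset0Pn; exists 0%R.
split.
- by move=> L /= [L0 QL]; rewrite in_translate subrr.
- by move=> L L' _ _; exact: (can_inj (@translateK x)).
- move=> L /= [xL QL]; exists (translate (- x)%R L) => /=.
    rewrite in_translate opprK add0r; split=> //.
    by rewrite -{1}(opprK x) translateK.
  by rewrite -{1}(opprK x) translateK.
Qed.

Definition potential_norm : R := fine (esum [set L : {fset Zd} | 0%R \in L] c).
Local Notation P := potential_norm.

Lemma potential_normE : esum [set L : {fset Zd} | 0%R \in L] c = P%:E.
Proof.
rewrite fineK// ge0_fin_numE//; apply: esum_ge0 => L _.
exact: interaction_norm_ge0.
Qed.

Lemma esum_at_le x (Q : set {fset Zd}) :
  esum [set L : {fset Zd} | x \in L /\ Q L] c <= P%:E.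
Proof.
rewrite esum_translate -potential_normE; apply: subset_le_esum.
by move=> L [].
Qed.

Lemma esum_meets_lt_pinfty V :
  esum [set L : {fset Zd} | (L `&` V)%fset != fset0] c < +oo.
Proof.
apply: (@le_lt_trans _ _ (\sum_(x <- V) P%:E)).
  apply: le_trans (lee_sum _ (fun x _ => @esum_at_le x setT)).
  apply: esum_cover; first exact: interaction_norm_ge0.
  by move=> L /= /fset0Pn[x]; rewrite inE => /andP[xL xV]; exists x.
by rewrite sumEFin ltry.
Qed.

Definition boundary_sets V : set {fset Zd} :=
  [set L : {fset Zd} | (L `&` V)%fset != fset0 /\ ~~ (L `<=` V)%fset].

Definition boundary_energy V : R := fine (esum (boundary_sets V) c).

Lemma boundary_energyE V : esum (boundary_sets V) c = (boundary_energy V)%:E.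
Proof.
rewrite fineK// ge0_fin_numE; last first.
  by apply: esum_ge0 => L _; exact: interaction_norm_ge0.
apply: le_lt_trans (esum_meets_lt_pinfty V); apply: subset_le_esum.
by move=> L [].
Qed.

(** [B] is the union of finitely many sets that carry all but [eps] of the sum; a set not inside [B]
    is none of them. *)
Lemma interaction_tail (eps : R) : (0 < eps)%R -> exists B,
  esum [set L : {fset Zd} | 0%R \in L /\ ~~ (L `<=` B)%fset] c <= eps%:E.
Proof.
move=> eps0.
have [X [fX X0 XP]] := esum_tail interaction_norm_ge0 sumPhi eps0.
exists (\bigcup_(L <- fset_set X) L)%fset.
apply: le_trans XP; apply: subset_le_esum => L /= [L0 LB]; split=> //= XL.
by move: LB; rewrite bigfcup_sup// in_fset_set// mem_set.
Qed.

(** Charge each crossing set to a site [x] of [V] that it contains. If [x] is in [I], then [B + x]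
    lies in [V], so the set translated back by [x] leaves [B] and the tail bound [eps] applies; any
    other site costs at most the full norm. *)
Lemma boundary_energy_le V I B (eps : R) :
  0%R \in B -> (forall x y, x \in I -> y \in B -> (y + x)%R \in V) ->
  esum [set L : {fset Zd} | 0%R \in L /\ ~~ (L `<=` B)%fset] c <= eps%:E ->
  (boundary_energy V <= eps * #|` I|%:R + P * (#|` V|%:R - #|` I|%:R))%R.
Proof.
move=> B0 IBV BP; rewrite -lee_fin -boundary_energyE.
have IV : (I `<=` V)%fset.
  by apply/fsubsetP => x xI; rewrite -(add0r x); exact: IBV.
apply: (@le_trans _ _ (\sum_(x <- V) (if x \in I then eps else P)%:E)).
  apply: (@le_trans _ _ (\sum_(x <- V)
      esum [set L : {fset Zd} | x \in L /\ ~~ (L `<=` V)%fset] c)).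
    apply: esum_cover; first exact: interaction_norm_ge0.
    by move=> L /= [/fset0Pn[x]]; rewrite inE => /andP[xL xV] LV; exists x.
  apply: lee_sum => x _; case: ifPn => xI; last exact: esum_at_le.
  rewrite esum_translate; apply: le_trans BP; apply: subset_le_esum.
  move=> L /= [L0 LV]; split=> //; apply: contra LV => /fsubsetP LB.
  apply/fsubsetP => y; rewrite in_translate => /LB yB.
  by rewrite -(subrK x y); exact: IBV.
rewrite sumEFin lee_fin.
have -> : (\sum_(x <- V) (if x \in I then eps else P) =
    \sum_(x <- V) P + \sum_(x <- V) (if x \in I then eps - P else 0))%R.
  by rewrite -big_split; apply: eq_bigr => x _ /=; case: ifP => _; ring.
have -> : (\sum_(x <- V) (if x \in I then eps - P else 0) =
    \sum_(x <- I) (eps - P))%R.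
  rewrite -big_mkcond big_fset_condE; apply: eq_fbigl => x.
  by rewrite !inE/= andb_idl// => xI; exact: (fsubsetP IV).
rewrite !big_const_seq !count_predT !iter_addr_0.
rewrite -(mulr_natr P) -(mulr_natr (_ - _)).
by rewrite le_eqVlt; apply/orP; left; apply/eqP; ring.
Qed.

Lemma interaction_norm_fin L : L != fset0 -> c L \is a fin_num.
Proof.
move=> /fset0Pn[x xL]; rewrite ge0_fin_numE ?interaction_norm_ge0//.
(* Taking [Q := eq L] reduces the sum over sets through [x] to the single term at [L]. *)
apply: le_lt_trans (ltry P); apply: le_trans (@esum_at_le x (eq L)).
rewrite -(esum_set1 (interaction_norm_ge0 L)).
by apply: subset_le_esum => _ ->.
Qed.

(** Largest possible change of [Phi L] when the configuration is altered outside [V]: none if [L]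
    lies in [V], otherwise twice the norm. *)
Definition boundary_bound V L : R :=
  if (L `<=` V)%fset then 0%R else (fine (c L) + fine (c L))%R.

Lemma boundary_bound_ge0 V L : (0 <= boundary_bound V L)%R.
Proof.
by rewrite /boundary_bound; case: ifP => // _; rewrite addr_ge0// fine_ge0//
  interaction_norm_ge0.
Qed.

Lemma interaction_diff L V (p : {ffun V -> S}) eta eta' : L != fset0 ->
  (Phi L (glue_config p eta) <=
   Phi L (glue_config p eta') + boundary_bound V L)%R.
Proof.
rewrite /boundary_bound => L0; case: ifPn => LV.
  rewrite addr0 le_eqVlt; apply/orP; left; apply/eqP.
  by apply: (measurable_inP _ _).1 (potPhi L0) _ _ _; exact: agree_glue.
have le w : (`|Phi L w| <= fine (c L))%R.
  by rewrite -lee_fin fineK ?interaction_norm_fin// interaction_le.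
have := le (glue_config p eta); have := le (glue_config p eta').
rewrite !ler_norml; lra.
Qed.

Lemma esum_boundary_bound V :
  esum [set L : {fset Zd} | (L `&` V)%fset != fset0]
    (EFin \o boundary_bound V) =
  (2 * boundary_energy V)%:E.
Proof.
rewrite mulr_natl mulr2n EFinD -boundary_energyE -esumD; last 2 first.
- by move=> L _; exact: interaction_norm_ge0.
- by move=> L _; exact: interaction_norm_ge0.
rewrite (_ : boundary_sets V = [set L : {fset Zd} | (L `&` V)%fset != fset0]
   `&` [set L | ~~ (L `<=` V)%fset])//.
rewrite esum_mkcondr; apply: eq_esum => L /= /fset0Pn[x].
rewrite inE => /andP[xL _]; rewrite /boundary_bound.
have L0 : L != fset0 by apply/fset0Pn; exists x.
have [LV|LV] := boolP (L `<=` V)%fset.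
  by rewrite memNset//= => /negP; rewrite LV.
by rewrite mem_set// EFinD fineK// interaction_norm_fin.
Qed.

Lemma summable_interaction V w :
  esum [set L : {fset Zd} | (L `&` V)%fset != fset0]
    (abse \o (EFin \o (Phi^~ w))) < +oo.
Proof.
apply: le_lt_trans (esum_meets_lt_pinfty V); apply: le_esum => L _.
exact: interaction_le.
Qed.

Lemma hamiltonian_diff V (p : {ffun V -> S}) eta eta' :
  (hamiltonian Phi p eta <=
   hamiltonian Phi p eta' + 2 * boundary_energy V)%R.
Proof.
rewrite /hamiltonian.
have -> : (2 * boundary_energy V)%R = fine (esum
    [set L : {fset Zd} | (L `&` V)%fset != fset0] (EFin \o boundary_bound V)).
  by rewrite esum_boundary_bound.
apply: absolute_sum_le; try exact: summable_interaction.
- exact: boundary_bound_ge0.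
- by rewrite esum_boundary_bound ltry.
move=> L /= /fset0Pn[x]; rewrite inE => /andP[xL _].
by apply: interaction_diff; apply/fset0Pn; exists x.
Qed.

Local Open Scope ring_scope.

Lemma partition_function_gt0 V eta : 0 < partition_function Phi V eta.
Proof.
rewrite /partition_function (bigD1 [ffun=> point])//= ltr_pwDl ?expR_gt0//.
by apply: sumr_ge0 => p _; exact: expR_ge0.
Qed.

Lemma specification_ge0 V (p : {ffun V -> S}) eta :
  0 <= specification Phi p eta.
Proof. by rewrite divr_ge0 ?expR_ge0// ltW// partition_function_gt0. Qed.

(* Replacing the boundary condition costs [exp (2 b)] in the weight and [exp (2 b)]
   in the partition function. *)
Lemma specification_ratio V (p : {ffun V -> S}) eta eta' :
  specification Phi p eta <=
  expR (4 * boundary_energy V) * specification Phi p eta'.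
Proof.
set b := boundary_energy V.
have weight q e e' : expR (- hamiltonian Phi q e) <=
    expR (2 * b) * expR (- hamiltonian Phi (q : {ffun V -> S}) e').
  by rewrite -expRD ler_expR; have := hamiltonian_diff q e' e; rewrite -/b; lra.
have Z0 e := partition_function_gt0 V e.
rewrite /specification ler_pdivrMr// mulrA mulrAC ler_pdivlMr//.
rewrite (_ : expR (4 * b) = expR (2 * b) * expR (2 * b)); last first.
  by rewrite -expRD; congr expR; ring.
rewrite -!mulrA mulrCA !mulrA -[leRHS]mulrA.
apply: ler_pM; rewrite ?expR_ge0//.
  exact/ltW.
by rewrite /partition_function mulr_sumr; apply: ler_sum => q _; exact: weight.
Qed.

(** In the Gibbs equation for the cylinder of [p], only the term with pattern [p] survives, since
    gluing a pattern leaves it visible on [V]. *)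
Lemma gibbs_mass (mu : probability (borel_config S d) R) V
    (p : {ffun V -> S}) : is_gibbs Phi mu ->
  (\int[mu]_eta (specification Phi p eta)%:E = (mass mu p)%:E)%E.
Proof.
move=> gmu; rewrite -massE (gmu V); last first.
  by apply: local_set_measurable; exists V; exact: determined_cylinder.
apply: eq_integral => eta _; congr EFin.
rewrite (bigD1 p)//= big1 => [|q qp].
  by rewrite indicE mem_set ?mulr1 ?addr0// /cylinder/= restrict_glue.
by rewrite indicE memNset ?mulr0// /cylinder/= restrict_glue; exact/eqP.
Qed.

(** [specification_ratio] compares two independent boundary conditions: integrate one against [nu]
    with the other fixed, then the other against [mu]. *)
Lemma gibbs_mass_ratio (mu nu : probability (borel_config S d) R) V
    (p : {ffun V -> S}) : is_gibbs Phi mu -> is_gibbs Phi nu ->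
  mass nu p <= expR (4 * boundary_energy V) * mass mu p.
Proof.
move=> gmu gnu; set K := expR _.
have cstE (m : probability (borel_config S d) R) r : 
   (\int[m]_(_ in setT) r%:E = r%:E :> \bar R)%E.
  rewrite integral_cst// -[RHS]mule1; congr (_ * _)%E.
  exact: (@probability_setT _ _ _ m).
have nuK eta : mass nu p <= K * specification Phi p eta.
  rewrite -lee_fin -gibbs_mass// -(cstE nu); apply: le_integral_pointwise => eta'.
    by rewrite lee_fin specification_ge0.
  by rewrite lee_fin specification_ratio.
rewrite -ler_pdivrMl ?expR_gt0// -lee_fin -gibbs_mass// -(cstE mu).
apply: le_integral_pointwise => eta; rewrite lee_fin.
  by rewrite mulr_ge0 ?invr_ge0 ?expR_ge0 ?mass_ge0.
by rewrite ler_pdivrMl ?expR_gt0.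
Qed.

End BoundaryEnergy.

(** * Transfer of the Gaussian bound *)

Section EmpiricalSums.
Variables (R : realType) (S : pointedFinType) (d : nat).
Local Notation Zd := (lattice d).
Local Notation Omega := (config S d).
Implicit Types (mu nu : probability (borel_config S d) R).
Variables (A : set Omega) (L V I : {fset Zd}).
Hypotheses (dA : determined_by L A)
  (ILV : forall x y, x \in I -> y \in L -> y + x \in V).

Definition empirical_sum (t : R) (w : Omega) : R :=
  t * \sum_(x <- I) \1_A (shift_config (- x) w).

Lemma determined_shift x : x \in I ->
  determined_by V ((shift_config (- x)) @^-1` A : set Omega).
Proof.
move=> xI w w' ww'; apply: dA => y yL.
by rewrite /shift_config opprK ww'// ILV.
Qed.

Lemma determined_empirical_sum t : determined_by V (empirical_sum t).
Proof.
move=> w w' ww'; congr (t * _); apply: eq_big_seq => x xI.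
exact: (determined_indic R (determined_shift xI) ww').
Qed.

Lemma mean_empirical_sum mu t eta : shift_invariant mu ->
  \sum_(p : {ffun V -> S}) empirical_sum t (glue_config p eta) * mass mu p =
  t * #|` I|%:R * fine (mu (A : set (borel_config S d))).
Proof.
move=> imu.
have mA : measurable (A : set (borel_config S d)).
  by apply: local_set_measurable; exists L.
under eq_bigr do rewrite /empirical_sum -mulrA mulr_suml.
rewrite -mulr_sumr -mulrA exchange_big /=; congr (_ * _).
rewrite (eq_big_seq (fun=> fine (mu (A : set (borel_config S d))))) => [|x xI].
  by rewrite big_const_seq count_predT iter_addr_0 mulr_natl.
by rewrite -(imu (- x) _ mA) (prob_determined mu eta (determined_shift xI)).
Qed.

(** The site [y] is seen only by the translates with [y - x] in [L], of which there are at most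
    [#|L|], and by none if [y] is outside [V]. *)
Lemma empirical_sum_diff t w w' y : 0 <= t -> (forall z, z != y -> w z = w' z) ->
  `|empirical_sum t w - empirical_sum t w'| <=
  if y \in V then t * #|` L|%:R else 0.
Proof.
move=> t0 ww'; case: ifPn => yV; last first.
  rewrite (determined_empirical_sum t (w' := w')) ?subrr ?normr0// => z zV.
  by apply: ww'; apply: contraNneq yV => <-.
rewrite -mulrBr normrM ger0_norm// ler_wpM2l// -sumrB.
apply: le_trans (ler_norm_sum _ _ _) _.
apply: (@le_trans _ _ (\sum_(x <- I) (y - x \in L)%:R)).
  apply: ler_sum => x _; have [yL|yL] := boolP (y - x \in L).
    by rewrite !indicE; do 2 case: (_ \in A); rewrite /= ?subrr ?subr0 ?sub0r
      ?normrN ?normr0 ?normr1.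
  rewrite (determined_indic R dA (w' := shift_config (- x) w')).
    by rewrite subrr normr0.
  move=> z zL; rewrite /shift_config opprK ww'//.
  by apply: contraNneq yL => <-; rewrite addrK.
rewrite -natr_sum ler_nat -big_mkcond sum1_count.
rewrite -size_filter.
(* The injection sending [x] to [y - x] maps the affected translates into [L]. *)
apply: (@leq_trans #|` [fset y - x | x in [seq x <- I | y - x \in L]]%fset|).
  rewrite card_imfset /=; last by move=> x x' /(addrI y)/oppr_inj.
  by rewrite undup_id ?filter_uniq ?fset_uniq.
apply: fsubset_leq_card; apply/fsubsetP => z /imfsetP[x /=].
by rewrite mem_filter => /andP[yx _] ->.
Qed.

Lemma oscillation_empirical_sum t y : 0 <= t ->
  (oscillation (empirical_sum t) y <=
   (if y \in V then t * #|` L|%:R else 0)%:E)%E.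
Proof.
move=> t0; apply: ge_ereal_sup => _ [w [w' [ww' ->]]].
by rewrite lee_fin empirical_sum_diff.
Qed.

Lemma oscillation_ge0 (F : Omega -> R) y : (0 <= oscillation F y)%E.
Proof.
by apply: ereal_sup_ubound; exists point, point; rewrite subrr normr0.
Qed.

Lemma sum_oscillation t : 0 <= t ->
  (\esum_(x in [set: Zd]) (oscillation (empirical_sum t) x ^+ 2) <=
   (#|` V|%:R * (t * #|` L|%:R) ^+ 2)%:E)%E.
Proof.
move=> t0; set r := (t * _)%R.
have r0 : (0 <= (r ^+ 2)%:E :> \bar R)%E by rewrite lee_fin sqr_ge0.
apply: (@le_trans _ _ (\esum_(x in [set` V]) (r ^+ 2)%:E)).
  rewrite [leRHS]esum_mkcond; apply: le_esum => x _.
  have o0 := oscillation_ge0 (empirical_sum t) x.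
  have := oscillation_empirical_sum x t0.
  case: ifPn => xV ox; last first.
    have -> : oscillation (empirical_sum t) x = 0%E.
      by apply/eqP; rewrite eq_le ox o0.
    by rewrite expe2 mul0e; case: ifP.
  by rewrite mem_set// expe2 expr2 EFinM lee_pmul.
apply: le_trans (_ : _ <= \sum_(x <- V) \esum_(y in [set x]) (r ^+ 2)%:E)%E _.
  by apply: esum_cover => // x xV; exists x.
under eq_bigr do rewrite esum_set1//.
by rewrite sumEFin lee_fin big_const_seq count_predT iter_addr_0 mulr_natl.
Qed.

End EmpiricalSums.

(** * Comparison of two equilibrium states *)

Section Comparison.
Variables (R : realType) (S : pointedFinType) (d : nat).
Local Notation Zd := (lattice d).
Local Notation Omega := (config S d).
Implicit Types (mu nu : probability (borel_config S d) R).

(** Both sides become finite expressions: the exponential moment is a sum over patterns on [V], a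
    form in which the masses of [mu] can be exchanged for those of [nu]. *)
Lemma gaussian_empirical_sum mu (D t : R) (A : set Omega)
    (L V I : {fset Zd}) eta :
  (forall F : Omega -> R, is_local F ->
    (\int[mu]_w (expR (F w - \int[mu]_w' F w')%R)%:E
     <= expeR (D%:E * \esum_(x in [set: Zd]) (oscillation F x ^+ 2)))%E) ->
  shift_invariant mu -> 0 < D -> 0 <= t -> determined_by L A ->
  (forall x y, x \in I -> y \in L -> y + x \in V) ->
  \sum_(p : {ffun V -> S})
     expR (empirical_sum A I t (glue_config p eta) -
       t * #|` I|%:R * fine (mu (A : set (borel_config S d)))) * mass mu p <=
  expR (D * (#|` V|%:R * (t * #|` L|%:R) ^+ 2)).
Proof.
move=> gcb imu D0 t0 dA ILV; pose F : Omega -> R := empirical_sum A I t.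
have dF : determined_by V F := determined_empirical_sum dA ILV t.
have locF : is_local F by exists V; apply/measurable_inP.
have mF : \int[mu]_w F w =
    t * #|` I|%:R * fine (mu (A : set (borel_config S d))).
  rewrite /Rintegral (integral_determined mu eta dF) /=.
  exact: (mean_empirical_sum dA ILV).
have := gcb F locF; rewrite mF.
rewrite (integral_determined mu eta (V := V)
  (F := fun w => expR (F w - _))); last first.
  by move=> w w' /dF ->.
rewrite -lee_fin => /le_trans; apply.
rewrite -[leRHS]/(expeR (_)%:E) lee_expeR EFinM lee_pmul2l ?lte_fin//.
exact: sum_oscillation.
Qed.

(** Average the tangent inequality [1 + u <= expR u] at [u = f j - s] against the weights [q]; the
    right-hand side is then at most [1]. *)
Lemma jensen_expR (J : finType) (q f : J -> R) (s : R) :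
  (forall j, 0 <= q j) -> \sum_j q j = 1 ->
  \sum_j expR (f j) * q j <= expR s -> \sum_j f j * q j <= s.
Proof.
move=> q0 q1 fs.
have : \sum_j (1 + (f j - s)) * q j <= \sum_j expR (f j - s) * q j.
  by apply: ler_sum => j _; rewrite ler_wpM2r// expR_ge1Dx.
under [leRHS]eq_bigr do rewrite expRB mulrAC.
rewrite -mulr_suml => /le_trans => /(_ 1).
rewrite ler_pdivrMr ?expR_gt0// mul1r => /(_ fs).
under eq_bigr do rewrite mulrDl mul1r mulrBl.
by rewrite big_split sumrB /= -mulr_sumr q1 mulr1; lra.
Qed.

(* Divide by [n] and let [eps] tend to [0], then divide by [t] and let [t] tend
   to [0]. *)
Lemma density_bound (P K a : R) : 0 <= P -> 0 <= K ->
  (forall t eps, 0 < t -> 0 < eps < 1 -> exists n k : R,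
     [/\ 0 < n, k <= n, (1 - eps) * n <= k &
      t * k * a <= 4 * (eps * k + P * (n - k)) + K * n * t ^+ 2]) ->
  a <= 0.
Proof.
move=> P0 K0 H; rewrite leNgt; apply/negP => a0.
(* This [t] makes the quadratic term [K * n * t ^+ 2] at most a quarter of [t * a * n]. *)
pose t := a / (4 * (K + 1)).
have t0 : 0 < t by rewrite divr_gt0// mulr_gt0//; lra.
have ta0 : 0 < t * a by rewrite mulr_gt0.
have Q0 : 0 < 16 * (1 + P) + 4 * (t * a) by lra.
(* The two summands of the denominator give [16 * eps * (1 + P) <= t * a], so that the boundary term
   is at most a quarter of [t * a * n], and [eps <= 1 / 4]. *)
pose eps := t * a / (16 * (1 + P) + 4 * (t * a)).
have eps0 : 0 < eps by rewrite divr_gt0.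
have epsE : eps * (16 * (1 + P) + 4 * (t * a)) = t * a.
  by rewrite divfK// gt_eqF.
have tE : t * (4 * (K + 1)) = a by rewrite divfK// gt_eqF// mulr_gt0//; lra.
have epsP : 0 <= eps * (1 + P) by rewrite mulr_ge0; lra.
have eps4 : eps <= 1 / 4.
  rewrite -(ler_pM2r ta0).
  have : eps * (4 * (t * a)) <= t * a by rewrite -[leRHS]epsE; nra.
  by lra.
have [|n [k [n0 kn nk]]] := H t eps t0; first by lra.
have ek : eps * k <= eps * n by rewrite ler_wpM2l// ltW.
have Pk : P * (n - k) <= P * (eps * n) by rewrite ler_wpM2l//; lra.
have tk : t * a * ((1 - eps) * n) <= t * a * k by rewrite ler_wpM2l// ltW.
have e1 : eps * (1 + P) * 16 <= t * a by rewrite -[leRHS]epsE; nra.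
have Kt : K * t ^+ 2 * 4 <= t * a.
  rewrite -[in leRHS]tE; rewrite expr2; have : 0 <= t * t by rewrite mulr_ge0 ?ltW.
  by nra.
have n1 : eps * (1 + P) * 16 * n <= t * a * n by rewrite ler_wpM2r// ltW.
have n2 : K * t ^+ 2 * 4 * n <= t * a * n by rewrite ler_wpM2r// ltW.
have n3 : eps * (t * a * n) <= 1 / 4 * (t * a * n).
  by rewrite ler_wpM2r// mulr_ge0 ?ltW.
have n4 : 0 < t * a * n by rewrite mulr_gt0.
(* The left side of [main] is at least three quarters of [t * a * n], the right side at most one
   half. *)
move=> main; nra.
Qed.

Lemma equilibrium_le (Phi : {fset Zd} -> Omega -> R) mu nu (A : set Omega) :
  is_potential Phi -> shift_invariant_potential Phi -> uniformly_summable Phi ->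
  is_equilibrium Phi mu -> is_equilibrium Phi nu -> gaussian_concentration mu ->
  local_sets A ->
  fine (nu (A : set (borel_config S d))) <= fine (mu (A : set (borel_config S d))).
Proof.
move=> pot shi sum [imu gmu] [inu gnu] [D D0 gcb] [L dA].
rewrite -subr_le0; set a := _ - _.
apply: (@density_bound (potential_norm Phi) (D * #|` L|%:R ^+ 2)).
- by apply: fine_ge0; apply: esum_ge0 => *; exact: interaction_norm_ge0.
- by rewrite mulr_ge0 ?sqr_ge0 ?ltW.
move=> t eps t0 /andP[eps0 eps1].
have [B BP] := interaction_tail sum eps0.
(* One window serves three purposes: the origin gives [I] inside [V], [B] controls the boundary
   energy, and [L] keeps the translates of [A] local to [V]. *)
have [V [I [V0 IV VI]]] := folner (0 |` (B `|` L))%fset eps0.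
exists #|` V|%:R, #|` I|%:R; split; rewrite ?ltr0n ?ler_nat//.
  apply: fsubset_leq_card; apply/fsubsetP => x xI.
  by rewrite -(add0r x) IV// !inE eqxx.
have ILV x y : x \in I -> y \in L -> y + x \in V.
  by move=> xI yL; rewrite IV// !inE yL !orbT.
have bE := @boundary_energy_le R S d Phi shi sum V I (0 |` B)%fset eps.
set b := boundary_energy Phi V in bE.
have {}bE : b <= eps * #|` I|%:R + potential_norm Phi * (#|` V|%:R - #|` I|%:R).
  apply: bE; first by rewrite !inE eqxx.
    by move=> x y xI /[!inE]/orP[/eqP ->|yB]; rewrite IV// !inE ?eqxx ?yB ?orbT.
  apply: le_trans BP; apply: subset_le_esum => J /= [J0 JB]; split=> //.
  by apply: contra JB => JB; apply: fsubset_trans JB (fsubsetUr _ _).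
have gauss := gaussian_empirical_sum point gcb imu D0 (ltW t0) dA ILV.
set s := D * _ in gauss; set c := t * _ * _ in gauss.
(* The exponential moment under [nu] is at most [expR (4 * b)] times that under [mu]; Jensen's
   inequality then bounds the mean under [nu] of the sum centred at its mean under [mu]. *)
have : \sum_(p : {ffun V -> S})
    (empirical_sum A I t (glue_config p point) - c) * mass nu p <= 4 * b + s.
  apply: jensen_expR; [by move=> p; exact: mass_ge0|exact: sum_mass|].
  rewrite expRD; apply: le_trans (ler_wpM2l (expR_ge0 _) gauss).
  rewrite mulr_sumr; apply: ler_sum => p _; rewrite mulrCA ler_wpM2l ?expR_ge0//.
  exact: gibbs_mass_ratio.
under eq_bigr do rewrite mulrBl.
rewrite sumrB -mulr_sumr sum_mass mulr1 (mean_empirical_sum dA ILV)//.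
rewrite /c -mulrBr -/a /s exprMn => main.
by have := ler_wpM2l (ler0n R 4) bE; lra.
Qed.

End Comparison.

Theorem mainTheorem1 (R : realType) (S : pointedFinType) (d : nat)
    (d_gt0 : (0 < d)%N)
    (Phi : {fset lattice d} -> config S d -> R)
    (potPhi : is_potential Phi)
    (shiftPhi : shift_invariant_potential Phi)
    (sumPhi : uniformly_summable Phi)
    (mu : probability (borel_config S d) R)
    (eqmu : is_equilibrium Phi mu)
    (ergmu : is_ergodic mu)
    (gcbmu : gaussian_concentration mu) :
  is_equilibrium Phi mu /\
  forall nu : probability (borel_config S d) R, is_equilibrium Phi nu ->
    forall A : set (borel_config S d), measurable A -> nu A = mu A.
Proof.
split=> // nu eqnu; apply: eq_of_local => A locA.
have le B := equilibrium_le (A := B) potPhi shiftPhi sumPhi eqmu eqnu gcbmu.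
have mA := local_set_measurable locA.
have fin (m : probability (borel_config S d) R) B : measurable B ->
    m B \is a fin_num by exact: fin_num_measure.
have compl (m : probability (borel_config S d) R) :
    fine (m (~` A)) = 1 - fine (m A).
  by rewrite probability_setC// fineB// fin.
have locC : local_sets (~` A).
  have [L dA] := locA; exists L => w w' ww'; rewrite /setC /=.
  by congr (~ _); exact: dA.
rewrite -(fineK (fin nu _ mA)) -(fineK (fin mu _ mA)); congr EFin.
apply/eqP; rewrite eq_le le//=.
(* Passing to the complement reverses the inequality. *)
by have := le _ locC; rewrite !compl lerD2l lerN2.
Qed.
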